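(* For each pair of integers $p\ge 3$ and $q\ge 2$, the group $\Gamma=\Delta(p,q,\infty)=\langle X,Y,Z\mid X^p=Y^q=XYZ=1\rangle$ has uncountably many conjugacy classes of nonparabolic maximal subgroups which are not Neumann subgroups.
   Context: The parabolic elements of $\Gamma=\langle X,Y,Z\mid X^p=Y^q=XYZ=1\rangle\cong C_p*C_q$ are the conjugates in $\Gamma$ of the non-identity powers of $Z$. A nonparabolic maximal subgroup of $\Gamma$ is a subgroup which is a maximal (proper) subgroup of $\Gamma$ and contains no parabolic elements. A Neumann subgroup of $\Gamma$ is a subgroup $M$ which complements the maximal parabolic subgroup $P=\langle Z\rangle$, that is, $\Gamma=MP$ and $M\cap P=1$. *)

(* Defs.v *)
From HB Require Import structures.
From mathcomp Require Import all_boot all_classical.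

Set Implicit Arguments.
Unset Strict Implicit.
Unset Printing Implicit Defensive.

Local Open Scope classical_set_scope.
Local Open Scope quotient_scope.
Local Open Scope group_scope.

(* The letter (i, false) stands for the generator i, (i, true) for its inverse. *)
Definition word (I : Type) := seq (I * bool).

Definition inv_letter (I : Type) (a : I * bool) := (a.1, ~~ a.2).
Definition inv_word (I : Type) (w : word I) : word I := rev (map (@inv_letter I) w).

(* The least congruence on words that cancels inverse letters and kills the
   relators in R: two words are related iff they have the same value in the
   group < I | R >. *)
Inductive wcong (I : Type) (R : set (word I)) : word I -> word I -> Prop :=
| wcong_refl u : wcong R u u
| wcong_sym u v : wcong R u v -> wcong R v u
| wcong_trans u v w : wcong R u v -> wcong R v w -> wcong R u w
| wcong_cat u u' v v' :
    wcong R u u' -> wcong R v v' -> wcong R (u ++ v) (u' ++ v')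
| wcong_cancel a : wcong R [:: a; inv_letter a] [::]
| wcong_rel r : R r -> wcong R r [::].

Lemma inv_letterK I : involutive (@inv_letter I).
Proof. by case=> i b; rewrite /inv_letter negbK. Qed.

Lemma inv_word_cat I (u v : word I) :
  inv_word (u ++ v) = inv_word v ++ inv_word u.
Proof. by rewrite /inv_word map_cat rev_cat. Qed.

Lemma inv_wordK I : involutive (@inv_word I).
Proof.
by move=> u; rewrite /inv_word map_rev revK mapK //; exact: inv_letterK.
Qed.

Lemma wcong_mulVw I (R : set (word I)) (u : word I) :
  wcong R (inv_word u ++ u) [::].
Proof.
elim: u => [|a u IHu]; first exact: wcong_refl.
rewrite -cat1s inv_word_cat -catA; apply: wcong_trans IHu.
apply: wcong_cat; first exact: wcong_refl.
rewrite catA -[X in wcong _ _ X]cat0s.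
apply: wcong_cat; last exact: wcong_refl.
by rewrite -[X in _ ++ [:: X]]inv_letterK; exact: wcong_cancel.
Qed.

Lemma wcong_mulwV I (R : set (word I)) (u : word I) :
  wcong R (u ++ inv_word u) [::].
Proof. by rewrite -{1}(inv_wordK u); exact: wcong_mulVw. Qed.

Lemma wcong_inv I (R : set (word I)) (u v : word I) :
  wcong R u v -> wcong R (inv_word u) (inv_word v).
Proof.
move=> uv; apply: (@wcong_trans _ _ _ (inv_word u ++ (v ++ inv_word v))).
  rewrite -[X in wcong _ X _]cats0.
  apply: wcong_cat; first exact: wcong_refl.
  exact/wcong_sym/wcong_mulwV.
rewrite catA -[X in wcong _ _ X]cat0s.
apply: wcong_cat; last exact: wcong_refl.
apply: wcong_trans (wcong_mulVw R u).
by apply: wcong_cat; [exact: wcong_refl|exact: wcong_sym].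
Qed.

Section Presented.
Variables (I : choiceType) (R : set (word I)).

Definition wcongb (u v : word I) : bool := `[< wcong R u v >].

Lemma wcongb_refl : reflexive wcongb.
Proof. by move=> u; apply/asboolP/wcong_refl. Qed.
Lemma wcongb_sym : symmetric wcongb.
Proof. by move=> u v; apply/asboolP/asboolP => /wcong_sym. Qed.
Lemma wcongb_trans : transitive wcongb.
Proof.
by move=> v u w /asboolP uv /asboolP vw; apply/asboolP/(wcong_trans uv vw).
Qed.

Canonical wcongb_equiv := EquivRel wcongb wcongb_refl wcongb_sym wcongb_trans.

Definition presented := {eq_quot wcongb}.
HB.instance Definition _ := Choice.on presented.
HB.instance Definition _ := EqQuotient.on presented.

Definition pres_of (w : word I) : presented := \pi_presented w.

Lemma pres_ofP u v : pres_of u = pres_of v <-> wcong R u v.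
Proof.
by split=> [/eqmodP/asboolP|uv]; last by apply/eqmodP/asboolP.
Qed.

Lemma pres_reprK (x : presented) : pres_of (repr x) = x.
Proof. exact: reprK. Qed.

Definition pres_one : presented := pres_of [::].
Definition pres_mul (x y : presented) := pres_of (repr x ++ repr y).
Definition pres_inv (x : presented) := pres_of (inv_word (repr x)).

Lemma pres_of_cat u v : pres_of (u ++ v) = pres_mul (pres_of u) (pres_of v).
Proof. by apply/pres_ofP/wcong_cat; apply/pres_ofP; rewrite pres_reprK. Qed.

Lemma pres_of_inv u : pres_of (inv_word u) = pres_inv (pres_of u).
Proof. by apply/pres_ofP/wcong_inv/pres_ofP; rewrite pres_reprK. Qed.

Lemma pres_mulA : associative pres_mul.
Proof.
move=> x y z; rewrite -(pres_reprK x) -(pres_reprK y) -(pres_reprK z).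
by rewrite -!pres_of_cat catA.
Qed.

Lemma pres_mul1g : left_id pres_one pres_mul.
Proof. by move=> x; rewrite -(pres_reprK x) -pres_of_cat. Qed.

Lemma pres_mulg1 : right_id pres_one pres_mul.
Proof. by move=> x; rewrite -(pres_reprK x) -pres_of_cat cats0. Qed.

Lemma pres_mulVg : left_inverse pres_one pres_inv pres_mul.
Proof.
move=> x; rewrite -(pres_reprK x) -pres_of_inv -pres_of_cat.
exact/pres_ofP/wcong_mulVw.
Qed.

Lemma pres_mulgV : right_inverse pres_one pres_inv pres_mul.
Proof.
move=> x; rewrite -(pres_reprK x) -pres_of_inv -pres_of_cat.
exact/pres_ofP/wcong_mulwV.
Qed.

HB.instance Definition _ := isGroup.Build presented
  pres_mulA pres_mul1g pres_mulg1 pres_mulVg pres_mulgV.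

Definition pres_gen (i : I) : presented := pres_of [:: (i, false)].

End Presented.

Variant tgen := tX | tY | tZ.
HB.instance Definition _ := gen_eqMixin tgen.
HB.instance Definition _ := gen_choiceMixin tgen.

Definition triangle_relators (p q : nat) : set (word tgen) :=
  [set nseq p (tX, false); nseq q (tY, false);
       [:: (tX, false); (tY, false); (tZ, false)]].

Definition Delta (p q : nat) := presented (triangle_relators p q).
HB.instance Definition _ p q := Group.on (Delta p q).

Definition DeltaX p q : Delta p q := pres_gen (triangle_relators p q) tX.
Definition DeltaY p q : Delta p q := pres_gen (triangle_relators p q) tY.
Definition DeltaZ p q : Delta p q := pres_gen (triangle_relators p q) tZ.

Definition is_subgroup (G : groupType) (M : set G) : Prop :=
  group_closed (mem M).

Definition maximal_subgroup (G : groupType) (M : set G) : Prop :=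
  [/\ is_subgroup M, M <> setT &
      forall H : set G, is_subgroup H -> M `<=` H -> H = M \/ H = setT].

Definition powers (G : groupType) (z : G) : set G :=
  [set x | exists n : nat, x = z ^+ n \/ x = z ^- n].

Definition conj_subset (G : groupType) (M : set G) (g : G) : set G :=
  [set x ^ g | x in M].

Definition conjugacy_class (G : groupType) (M : set G) : set (set G) :=
  [set conj_subset M g | g in setT].

Definition parabolic (p q : nat) : set (Delta p q) :=
  [set x | exists z g : Delta p q,
     [/\ powers (DeltaZ p q) z, z <> 1 & x = z ^ g]].

Definition nonparabolic_maximal (p q : nat) (M : set (Delta p q)) : Prop :=
  maximal_subgroup M /\ forall x, M x -> ~ parabolic x.

Definition neumann_subgroup (p q : nat) (M : set (Delta p q)) : Prop :=
  [/\ is_subgroup M,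
      [set m * z | m in M & z in powers (DeltaZ p q)] = setT &
      M `&` powers (DeltaZ p q) = [set 1]].

(* Main.v *)
Require Import Defs.
From mathcomp Require Import all_boot all_algebra all_classical zify.

(** The group acts on the right on a set as soon as two permutations X and Y of
    that set satisfy X^p = Y^q = 1, and Z^-1 then acts as XY (first X, then Y).
    For the stabilizer M of a point w this turns the three properties into
    combinatorics of the orbit of w: M is nonparabolic when XY has only infinite
    cycles (stab_nonparabolic), M is not a Neumann subgroup when XY has more
    than one cycle (stab_not_neumann), and M is maximal when the action is
    primitive (stab_maximal).

    The actions used are drawn as plane trees whose nodes are the cycles of X
    and Y and whose edges are the points; the cycles of XY are the faces. The
    tree is a two-ended caterpillar. Its spine alternates X-cycles of length p,
    indexed by the integers, and Y-cycles of length q. The p-2 remaining points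
    of every X-cycle hang above the spine and are fixed by Y, the q-2 remaining
    points of every Y-cycle hang below it and are fixed by X. There are exactly
    two faces, the top and the bottom, and both are infinite. The decoration
    lies on the top: at some of the X-cycles with nonnegative index the first
    hanging point, instead of being fixed by Y, is on a Y-cycle whose other q-1
    points are fixed by X (a twig). There is always a twig at index 0, and at
    the positive indices the twigs are prescribed by an arbitrary sequence of
    bits.

    The primitivity argument: let E be an equivalence relation that X and Y
    preserve, with w E c for some c <> w. Then E identifies two points of the
    top face. This is clear if c is on top. If c is at the bottom, a Y-fixed top
    point is equivalent to some bottom point and to the image of the latter
    under Y, which gives two equivalent points of one face, and X carries a
    coincidence at the bottom to the top (congruence_period). So E is periodic
    on the top face, with a period d > 0. Now t = XY(w), the first point of the
    twig at index 0, is fixed by X, and moving back along the face by d leads to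
    an equivalent point c' that is w or belongs to an X-cycle of negative index.
    If c' = w, then w is equivalent to its successor t. Otherwise the whole
    X-cycle of c' is equivalent to t, because t is fixed by X, and this cycle
    contains two consecutive points of the face. So the period is 1
    (period_top). The class of w then contains the top face, on which X has a
    point with image on top and Y has a fixed point, so X and Y both preserve
    the class and it is the whole orbit (congruence_closed).

    The bit at n can be read off the stabilizer, by whether it contains the
    conjugate of Y that tests for a twig at index n+1 (caterpillar_stab_inj). So
    there are as many stabilizers as sequences of bits, and since the group is
    countable, so is each conjugacy class; hence the classes are uncountably
    many. *)

Set Implicit Arguments.
Unset Strict Implicit.
Unset Printing Implicit Defensive.

Local Open Scope classical_set_scope.

(** * Actions of the triangle group and their point stabilizers *)

Section TriangleAction.
Variables (p q : nat) (Om : Type) (X Y : Om -> Om).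
Hypotheses (p_gt0 : (0 < p)%N) (q_gt0 : (0 < q)%N).
Hypotheses (X_period : forall a, iter p X a = a)
           (Y_period : forall a, iter q Y a = a).

Definition XY (a : Om) := Y (X a).
(** The action of Z; inverses are taken as powers so that no inverse functions
    have to be carried along with X and Y. *)
Definition XYinv (a : Om) := iter p.-1 X (iter q.-1 Y a).

Definition letter_act (l : tgen * bool) : Om -> Om :=
  match l with
  | (tX, false) => X
  | (tX, true) => iter p.-1 X
  | (tY, false) => Y
  | (tY, true) => iter q.-1 Y
  | (tZ, false) => XYinv
  | (tZ, true) => XY
  end.

Definition word_act (w : word tgen) (a : Om) :=
  foldl (fun a l => letter_act l a) a w.

Definition act (g : Delta p q) : Om -> Om := word_act (repr g).

Lemma X_predK a : iter p.-1 X (X a) = a.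
Proof. by rewrite -iterSr prednK. Qed.
Lemma X_Kpred a : X (iter p.-1 X a) = a.
Proof. by rewrite -iterS prednK. Qed.
Lemma Y_predK a : iter q.-1 Y (Y a) = a.
Proof. by rewrite -iterSr prednK. Qed.
Lemma Y_Kpred a : Y (iter q.-1 Y a) = a.
Proof. by rewrite -iterS prednK. Qed.
Lemma XYK : cancel XY XYinv.
Proof. by move=> a; rewrite /XYinv /XY Y_predK X_predK. Qed.
Lemma XYinvK : cancel XYinv XY.
Proof. by move=> a; rewrite /XYinv /XY X_Kpred Y_Kpred. Qed.

Lemma letter_actK l : cancel (letter_act l) (letter_act (inv_letter l)).
Proof.
case: l => [[] []] a /=;
  by rewrite ?X_predK ?X_Kpred ?Y_predK ?Y_Kpred ?XYK ?XYinvK.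
Qed.

Lemma word_act_cat u v a : word_act (u ++ v) a = word_act v (word_act u a).
Proof. exact: foldl_cat. Qed.

Lemma word_act_nseq n l a : word_act (nseq n l) a = iter n (letter_act l) a.
Proof. by elim: n a => //= n IHn a; rewrite IHn -iterSr. Qed.

Lemma word_act_wcong u v :
  wcong (triangle_relators p q) u v -> word_act u =1 word_act v.
Proof.
elim=> {u v} [//|u v _ IH a|u v w _ IH1 _ IH2 a|u u' v v' _ IHu _ IHv a|l a|r].
- by rewrite IH.
- by rewrite IH1.
- by rewrite !word_act_cat IHu IHv.
- exact: letter_actK.
by case=> [[|]|] -> a; rewrite ?word_act_nseq //; exact: XYK.
Qed.

Lemma act_pres_of w a : act (pres_of _ w) a = word_act w a.
Proof. by apply: word_act_wcong; apply/pres_ofP; rewrite pres_reprK. Qed.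

Lemma act1 a : act 1%g a = a.
Proof. exact: act_pres_of. Qed.

Lemma actM g h a : act (g * h)%g a = act h (act g a).
Proof. by rewrite act_pres_of word_act_cat. Qed.

Lemma actK g : cancel (act g) (act g^-1%g).
Proof. by move=> a; rewrite -actM mulgV act1. Qed.
Lemma actVK g : cancel (act g^-1%g) (act g).
Proof. by move=> a; rewrite -actM mulVg act1. Qed.

Lemma actX a : act (DeltaX p q) a = X a.
Proof. exact: act_pres_of. Qed.
Lemma actY a : act (DeltaY p q) a = Y a.
Proof. exact: act_pres_of. Qed.
Lemma actZ a : act (DeltaZ p q) a = XYinv a.
Proof. exact: act_pres_of. Qed.

Lemma actZX n a : act (DeltaZ p q ^+ n)%g a = iter n XYinv a.
Proof.
by elim: n => [|n IHn]; rewrite ?act1 // expgSr actM IHn actZ.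
Qed.

Lemma iter_XYinvK n : cancel (iter n XYinv) (iter n XY).
Proof. by elim: n => // n IHn a; rewrite iterSr iterS XYinvK IHn. Qed.
Lemma iter_XYK n : cancel (iter n XY) (iter n XYinv).
Proof. by elim: n => // n IHn a; rewrite iterSr iterS XYK IHn. Qed.

(** The inverses of the generators act as positive powers of X and Y, so closure
    under X and Y suffices. *)
Lemma act_closed (P : Om -> Prop) :
  (forall a, P a -> P (X a)) -> (forall a, P a -> P (Y a)) ->
  forall g a, P a -> P (act g a).
Proof.
move=> PX PY g; have Pit (h : Om -> Om) n :
  (forall a, P a -> P (h a)) -> forall a, P a -> P (iter n h a).
  by move=> Ph a Pa; elim: n => //= n; exact: Ph.
rewrite /act; elim: (repr g) => //= l w IHw a Pa; apply: IHw.
case: l => [[] []]; rewrite /= /XYinv /XY; auto.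
Qed.

Definition stab (w : Om) : set (Delta p q) := [set g | act g w = w].

Lemma stab_subgroup w : is_subgroup (stab w).
Proof.
split; first by rewrite inE; exact: act1.
move=> g h; rewrite !inE /stab /= => gw hw.
by rewrite actM gw -{1}hw actK.
Qed.

(** A subgroup H containing the stabilizer defines the relation
    that holds between wg and wh when g h^-1 is in H, and the class of w
    is wH.  That relation relates no points outside the orbit of w, which is why
    the criterion speaks of symmetric and transitive relations. *)
Lemma stab_maximal w :
  (exists g, act g w <> w) ->
  (forall E : Om -> Om -> Prop,
     (forall a b, E a b -> E b a) ->
     (forall a b c, E a b -> E b c -> E a c) ->
     (forall a b, E a b -> E (X a) (X b)) ->
     (forall a b, E a b -> E (Y a) (Y b)) ->
     forall g, E w (act g w) -> act g w <> w -> forall h, E w (act h w)) ->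
  maximal_subgroup (stab w).
Proof.
move=> [g0 g0w] prim; split; first exact: stab_subgroup.
  by move=> eqT; apply: g0w; suff: stab w g0 by []; rewrite eqT.
move=> H [H1 HB] sMH.
have HV g : H g -> H g^-1%g.
  move=> Hg; have:= HB 1%g g; rewrite !inE mul1g.
  by apply=> //; rewrite inE in H1.
have HM g h : H g -> H h -> H (g * h)%g.
  move=> Hg Hh; have := HB g h^-1%g; rewrite !inE invgK; apply=> //.
  exact: HV.
have Hcoset g h : act g w = act h w -> H (g * h^-1)%g.
  by move=> e; apply: sMH; rewrite /stab /= actM e actK.
pose E a b := exists g h, [/\ a = act g w, b = act h w & H (g * h^-1)%g].
have EH g : E w (act g w) <-> H g.
  split=> [[k [h [wk gh Hkh]]]|Hg]; last first.
    by exists 1%g, g; rewrite act1 mul1g; split=> //; exact: HV.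
  have Hk : H k by apply: sMH; rewrite /stab /= -wk.
  have Hh : H h^-1%g by rewrite -(mulKg k h^-1%g); apply: (HM) => //; exact: HV.
  rewrite -(mulgVK h g); apply: (HM); first exact: Hcoset.
  by rewrite -(invgK h); exact: HV.
have [[g [Hg ng]]|noH] := pselect (exists g, H g /\ act g w <> w); last first.
  left; apply/seteqP; split=> // g Hg; apply: contrapT => ng.
  by apply: noH; exists g.
right; apply/seteqP; split=> // h _; apply/EH.
apply: (prim E _ _ _ _ g) => //; last exact/EH.
- move=> a b [k [l [-> -> Hkl]]]; exists l, k; split=> //.
  by rewrite -(invgK l) -invgM; exact: HV.
- move=> a b c [k [l [-> -> Hkl]]] [l' [m [ll' -> Hlm]]].
  exists k, m; split=> //; rewrite -(mulgVK l k) -mulgA; apply: (HM) => //.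
  rewrite -(mulgVK l' l) -mulgA; apply: (HM) => //; exact: Hcoset.
- move=> a b [k [l [-> -> Hkl]]].
  exists (k * DeltaX p q)%g, (l * DeltaX p q)%g; rewrite !actM !actX; split=> //.
  by rewrite invgM mulgA mulgK.
- move=> a b [k [l [-> -> Hkl]]].
  exists (k * DeltaY p q)%g, (l * DeltaY p q)%g; rewrite !actM !actY; split=> //.
  by rewrite invgM mulgA mulgK.
Qed.

Lemma stab_nonparabolic w :
  (forall g n, iter n.+1 XY (act g w) <> act g w) ->
  forall x, stab w x -> ~ parabolic x.
Proof.
move=> nofix x xw [z [g [[n zn] z1 xz]]].
have fixz : act z (act g^-1%g w) = act g^-1%g w.
  apply: (can_inj (actVK g^-1%g)); rewrite invgK actVK.
  by rewrite -!actM; move: xw; rewrite /stab /= xz conjgE mulgA.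
have : iter n XY (act g^-1%g w) = act g^-1%g w.
  case: zn => ez; rewrite ez in fixz.
    by rewrite -{1}fixz actZX iter_XYinvK.
  by rewrite -{1}[act g^-1%g w](actVK (DeltaZ p q ^+ n)%g) fixz actZX iter_XYinvK.
case: n zn => [|n] zn; last exact: nofix.
by move=> _; apply: z1; case: zn => ->; rewrite ?expg0 ?invg1.
Qed.

(** A factorization of the group as M<Z> would make the XY-cycle of w the whole
    orbit; P separates w from some other XY-cycle. *)
Lemma stab_not_neumann w (P : Om -> Prop) :
  P w -> (forall a, P (XY a) <-> P a) -> (exists g, ~ P (act g w)) ->
  ~ neumann_subgroup (stab w).
Proof.
move=> Pw PXY [g nP] [_ MP _]; apply: nP.
have [m mw [z [n zn] <-]] :
    [set m * z | m in stab w & z in powers (DeltaZ p q)]%g g.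
  by rewrite MP.
rewrite actM mw; have Pn k a : P (iter k XY a) <-> P a.
  by elim: k => //= k IHk; rewrite PXY.
case: zn => ->; first by rewrite actZX -(Pn n) iter_XYinvK.
suff -> : act (DeltaZ p q ^- n)%g w = iter n XY w by apply/Pn.
by rewrite -{2}[w](actVK (DeltaZ p q ^+ n)%g) actZX iter_XYinvK.
Qed.

End TriangleAction.

(** * The caterpillar *)

(** Vertex n i is the point at place i of the n-th X-cycle: it starts with the
    spine point to the left (i = 0) and ends with the one to the right
    (i = p-1), and the points between them hang above the spine.  Joint n j
    hangs below the Y-cycle that links the X-cycles n and n+1, and Twig n j is on
    the twig of the X-cycle n.  The bounds on i and j are imposed by valid. *)
Inductive point := Vertex of int & nat | Joint of int & nat | Twig of int & nat.

(** The successor in the cyclic order of the numbers below m; the numbers from m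
    on are fixed so that the m-th iterate is the identity everywhere. *)
Definition csucc m i := if (i.+1 < m)%N then i.+1 else if i.+1 == m then 0%N else i.

Section Caterpillar.
Variables (p q : nat) (b : nat -> bool).
Hypotheses (p_ge3 : (3 <= p)%N) (q_ge2 : (2 <= q)%N).

Definition has_twig (n : int) : bool :=
  match n with Posz 0 => true | Posz k.+1 => b k | Negz _ => false end.

(** The Y-cycles of length q, each parametrized by the numbers below q. *)
Definition spine_cycle (n : int) (j : nat) :=
  if j == 0%N then Vertex n p.-1 else if j == 1%N then Vertex (n + 1)%R 0 else Joint n j.

Definition twig_cycle (n : int) (j : nat) := if j == 0%N then Vertex n 1 else Twig n j.

Definition catX a := if a is Vertex n i then Vertex n (csucc p i) else a.

Definition catY a :=
  match a with
  | Vertex n i =>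
      if i == p.-1 then spine_cycle n 1
      else if i == 0%N then spine_cycle (n - 1)%R (csucc q 1)
      else if (i == 1%N) && has_twig n then twig_cycle n 1
      else a
  | Joint n j => if (1 < j < q)%N then spine_cycle n (csucc q j) else a
  | Twig n j => if has_twig n && (0 < j < q)%N then twig_cycle n (csucc q j) else a
  end.

Lemma iter_csucc m i j : (i < m)%N -> (i + j < m)%N -> iter j (csucc m) i = (i + j)%N.
Proof.
move=> im; elim: j => [|j IHj] ijm; first by rewrite addn0.
rewrite iterS IHj; last by lia.
by rewrite /csucc -addnS ijm.
Qed.

Lemma csucc_period m i : iter m (csucc m) i = i.
Proof.
have [im|mi] := ltnP i m; last first.
  suff H k : iter k (csucc m) i = i by [].
  elim: k => //= k ->; rewrite /csucc.
  by case: ifP => [|_]; [lia|case: ifP => //; lia].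
have -> : i = iter i (csucc m) 0 by rewrite iter_csucc //; lia.
rewrite -iterD addnC iterD; congr iter.
have -> : m = m.-1.+1 by lia.
rewrite iterS iter_csucc /csucc; try lia.
by case: ifP => [|_]; [lia|case: ifP => //; lia].
Qed.

Lemma csucc_lt m i : (i < m)%N -> (csucc m i < m)%N.
Proof. by rewrite /csucc; case: ifP => // _; case: ifP => //; lia. Qed.

Lemma catX_period a : iter p catX a = a.
Proof.
case: a => [n i|n j|n j]; last 2 first.
- by elim: {1}p => //= k ->.
- by elim: {1}p => //= k ->.
suff -> k : iter k catX (Vertex n i) = Vertex n (iter k (csucc p) i) by rewrite csucc_period.
by elim: k => //= k ->.
Qed.

Lemma catY_spine n j : (j < q)%N -> catY (spine_cycle n j) = spine_cycle n (csucc q j).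
Proof.
case: j => [|[|j]] jq; rewrite /spine_cycle /=.
- by rewrite eqxx /csucc q_ge2.
- case: ifP => [|_]; first lia.
  by rewrite GRing.addrK.
- by rewrite jq.
Qed.

Lemma catY_twig n j : (j < q)%N -> has_twig n -> catY (twig_cycle n j) = twig_cycle n (csucc q j).
Proof.
case: j => [|j] jq tn; rewrite /twig_cycle /= tn ?jq //.
case: ifP => [|_]; first lia.
by rewrite /csucc q_ge2.
Qed.

Variant catY_spec : point -> Prop :=
| Yspine n j of (j < q)%N : catY_spec (spine_cycle n j)
| Ytwig n j of (j < q)%N & has_twig n : catY_spec (twig_cycle n j)
| Yfix a of catY a = a : catY_spec a.

Lemma catYP a : catY_spec a.
Proof.
case: a => [n i|n j|n j].
- have [->|i1] := eqVneq i p.-1; first by apply: (@Yspine n 0); lia.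
  have [->|i0] := eqVneq i 0%N.
    have -> : Vertex n 0 = spine_cycle (n - 1)%R 1 by rewrite /spine_cycle /= GRing.subrK.
    by apply: Yspine.
  case tn: ((i == 1%N) && has_twig n); last first.
    by apply: Yfix; rewrite /= (negPf i1) (negPf i0) tn.
  case/andP: tn => /eqP -> tn; apply: (@Ytwig n 0) => //; lia.
- case jq: (1 < j < q)%N; last by apply: Yfix; rewrite /= jq.
  have -> : Joint n j = spine_cycle n j.
    by rewrite /spine_cycle; do 2![case: ifP => [|_]; first lia].
  by apply: Yspine; lia.
- case jq: (has_twig n && (0 < j < q))%N; last by apply: Yfix; rewrite /= jq.
  have -> : Twig n j = twig_cycle n j.
    by rewrite /twig_cycle; case: ifP => [|_]; first lia.
  by case/andP: jq => tn jq; apply: Ytwig => //; lia.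
Qed.

Lemma catY_period a : iter q catY a = a.
Proof.
case: a / catYP => [n j jq|n j jq tn|a Ya].
- suff /(_ q)[-> _] k : iter k catY (spine_cycle n j) = spine_cycle n (iter k (csucc q) j) /\
    (iter k (csucc q) j < q)%N by rewrite csucc_period.
  by elim: k => //= k [-> lt]; rewrite catY_spine //; split=> //; exact: csucc_lt.
- suff /(_ q)[-> _] k : iter k catY (twig_cycle n j) = twig_cycle n (iter k (csucc q) j) /\
    (iter k (csucc q) j < q)%N by rewrite csucc_period.
  by elim: k => //= k [-> lt]; rewrite catY_twig //; split=> //; exact: csucc_lt.
- by elim: {1}q => //= k ->.
Qed.

Definition valid a :=
  match a with
  | Vertex _ i => (i < p)%N
  | Joint _ j => (1 < j < q)%N
  | Twig n j => has_twig n && (0 < j < q)%N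
  end.

Lemma valid_catX a : valid a -> valid (catX a).
Proof. by case: a => //= n i; exact: csucc_lt. Qed.

Lemma valid_catY a : valid a -> valid (catY a).
Proof.
case: a / catYP => [n j jq _|n j jq tn _|a -> //].
- rewrite catY_spine //; have := csucc_lt jq; rewrite /spine_cycle.
  by case: (csucc q j) => [|[|k]] /= => ?; lia.
- rewrite catY_twig //; have := csucc_lt jq; rewrite /twig_cycle.
  by case: (csucc q j) => [|k] /= => ?; rewrite ?tn; lia.
Qed.

Definition bottom a :=
  match a with Vertex _ i => i == p.-1 | Joint _ _ => true | Twig _ _ => false end.

Notation f := (XY catX catY).

(** An integer that XY strictly increases; its existence is what makes every
    face infinite.  The top face runs along the spine to the right and the bottom
    face to the left.  On either face fewer than p+q steps lead from one
    X-cycle to the next, and the shift by q leaves room for a twig between the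
    places 0 and 1 of an X-cycle. *)
Definition height (a : point) : int :=
  match a with
  | Vertex n i => if i == p.-1 then (- n * (p + q)%:Z)%R
              else if i == 0%N then (n * (p + q)%:Z)%R
              else (n * (p + q)%:Z + (i + q)%:Z)%R
  | Joint n j => (- (n + 1) * (p + q)%:Z + j%:Z)%R
  | Twig n j => (n * (p + q)%:Z + j%:Z)%R
  end.

(** The two faces, read step by step. *)
Variant XY_spec : point -> point -> Prop :=
| XYtwig0 n of has_twig n : XY_spec (Vertex n 0) (Twig n 1)
| XYtwig n j of has_twig n & (0 < j)%N & (j.+1 < q)%N : XY_spec (Twig n j) (Twig n j.+1)
| XYtwig_last n of has_twig n : XY_spec (Twig n q.-1) (Vertex n 1)
| XYleaf n i of (i.+2 < p)%N & ~~ ((i == 0%N) && has_twig n) :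
    XY_spec (Vertex n i) (Vertex n i.+1)
| XYnext n : XY_spec (Vertex n p.-2) (Vertex (n + 1)%R 0)
| XYspine0 n of (2 < q)%N : XY_spec (Vertex (n + 1)%R p.-1) (Joint n 2)
| XYspine2 n of q = 2 : XY_spec (Vertex (n + 1)%R p.-1) (Vertex n p.-1)
| XYspine n j of (1 < j)%N & (j.+1 < q)%N : XY_spec (Joint n j) (Joint n j.+1)
| XYspine_last n of (2 < q)%N : XY_spec (Joint n q.-1) (Vertex n p.-1).

Lemma XY_leaf n i : (i.+2 < p)%N -> ~~ ((i == 0%N) && has_twig n) ->
  f (Vertex n i) = Vertex n i.+1.
Proof.
move=> ip tn; rewrite /XY /catX /csucc ltnW //= eqSS (negPf tn).
by case: ifP => [|_]; first lia.
Qed.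

Lemma XY_twig_start n : has_twig n -> f (Vertex n 0) = Twig n 1.
Proof.
move=> tn; rewrite /XY /catX /csucc ltnW //= tn /=.
by case: ifP => [|_]; first lia.
Qed.

Lemma XY_twig n j : has_twig n -> (0 < j)%N -> (j.+1 < q)%N ->
  f (Twig n j) = Twig n j.+1.
Proof.
by move=> tn j0 jq; rewrite /XY /catX /catY tn j0 ltnW //= /csucc jq.
Qed.

Lemma XY_twig_end n : has_twig n -> f (Twig n q.-1) = Vertex n 1.
Proof.
move=> tn; rewrite /XY /catX /catY tn /csucc prednK; last lia.
by rewrite ltnn eqxx; case: ifP => // /negP[]; lia.
Qed.

Lemma XY_next n : f (Vertex n p.-2) = Vertex (n + 1)%R 0.
Proof.
rewrite /XY /catX /csucc; case: ifP => [_|]; last lia.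
rewrite /= prednK; last lia.
by rewrite eqxx.
Qed.

Lemma catY_first n : catY (Vertex n 0) = spine_cycle (n - 1)%R (csucc q 1).
Proof. by rewrite /=; case: ifP => [|_]; first lia. Qed.

Lemma catX_wrap n : catX (Vertex n p.-1) = Vertex n 0.
Proof. by rewrite /catX /csucc prednK ?ltnn ?eqxx //; lia. Qed.

Lemma XY_spine_start n : (2 < q)%N -> f (Vertex (n + 1)%R p.-1) = Joint n 2.
Proof.
by move=> q3; rewrite /XY catX_wrap catY_first GRing.addrK /csucc q3.
Qed.

Lemma XY_spine2 n : q = 2 -> f (Vertex (n + 1)%R p.-1) = Vertex n p.-1.
Proof. by move=> q2; rewrite /XY catX_wrap catY_first GRing.addrK /csucc q2. Qed.

Lemma XY_spine n j : (1 < j)%N -> (j.+1 < q)%N -> f (Joint n j) = Joint n j.+1.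
Proof.
move=> j1 jq; rewrite /XY /catX /catY j1 ltnW //= /csucc jq.
by case: j j1 {jq} => [|[]].
Qed.

Lemma XY_spine_end n : (2 < q)%N -> f (Joint n q.-1) = Vertex n p.-1.
Proof.
move=> q3; rewrite /XY /catX /catY /csucc prednK; last lia.
by rewrite ltnn eqxx; case: ifP => // /negP[]; lia.
Qed.

Lemma XYP a : valid a -> XY_spec a (f a).
Proof.
case: a => [n i|n j|n j].
- rewrite [valid _]/= => ip; have [ip1|] := ltnP i p.-2.
    case tn: ((i == 0%N) && has_twig n); last first.
      by rewrite XY_leaf ?tn //; [apply: XYleaf; rewrite ?tn //|]; lia.
    case/andP: tn => /eqP -> tn; rewrite XY_twig_start //; exact: XYtwig0.
  rewrite leq_eqVlt => /orP[/eqP <-|ip1].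
    rewrite XY_next; exact: XYnext.
  have -> : i = p.-1 by lia.
  rewrite -(GRing.subrK 1%R n); have [q3|q2] := ltnP 2 q.
    by rewrite XY_spine_start //; apply: XYspine0.
  have q2' : q = 2 by lia.
  by rewrite XY_spine2 //; apply: XYspine2.
- rewrite /valid => /andP[j1]; rewrite leq_eqVlt => /orP[/eqP jq|jq].
    have -> : j = q.-1 by lia.
    rewrite XY_spine_end; last lia.
    by apply: XYspine_last; lia.
  by rewrite XY_spine //; apply: XYspine.
- rewrite /valid => /and3P[tn j1]; rewrite leq_eqVlt => /orP[/eqP jq|jq].
    have -> : j = q.-1 by lia.
    by rewrite XY_twig_end //; apply: XYtwig_last.
  by rewrite XY_twig //; apply: XYtwig.
Qed.

Lemma height_XY a : valid a -> (height a < height (f a))%R.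
Proof.
move=> /XYP; move: (f a) => c; case=> /=.
- by move=> n _; case: ifP => [|_]; lia.
- by move=> *; lia.
- by move=> n _; case: ifP => [|_]; lia.
- move=> n i ip _; case: ifP => [|_]; first lia.
  by case: ifP => _; case: ifP => [|_]; lia.
- move=> n; case: ifP => [|_]; first lia.
  by case: ifP => [|_]; [lia|case: ifP => [|_]; lia].
- by move=> n q3; rewrite eqxx; lia.
- by move=> n q2; rewrite eqxx; lia.
- by move=> *; lia.
- by move=> n q3; rewrite eqxx; lia.
Qed.

Lemma bottom_XY a : valid a -> bottom (f a) = bottom a.
Proof.
by move=> /XYP; move: (f a) => c; case=> //= *; lia.
Qed.

Notation finv := (XYinv p q catX catY).

Lemma iter_finvK d : cancel (iter d finv) (iter d f).
Proof. by apply: iter_XYinvK; [lia|lia|exact: catX_period|exact: catY_period]. Qed.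

Lemma valid_iter (h : point -> point) k a :
  (forall a, valid a -> valid (h a)) -> valid a -> valid (iter k h a).
Proof. by move=> vh va; elim: k => //= k; exact: vh. Qed.

Lemma valid_XY a : valid a -> valid (f a).
Proof. by move=> va; apply/valid_catY/valid_catX. Qed.

Lemma valid_XYinv a : valid a -> valid (finv a).
Proof.
move=> va; apply: valid_iter; first exact: valid_catX.
by apply: valid_iter; first exact: valid_catY.
Qed.

Lemma bottom_iter k a : valid a -> bottom (iter k f a) = bottom a.
Proof.
move=> va; elim: k => //= k IHk; rewrite bottom_XY //.
by apply: valid_iter => //; exact: valid_XY.
Qed.

Lemma height_iter k a :
  valid a -> (height a + k%:Z <= height (iter k f a))%R.
Proof.
move=> va; elim: k => [|k IHk] /=; first by lia.
have := @height_XY (iter k f a) (valid_iter k valid_XY va); lia.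
Qed.

(** Being on the same face, expressed with forward iterates only. *)
Definition aligned a c := exists m k, iter m f a = iter k f c.

Lemma aligned_refl a : aligned a a.
Proof. by exists 0%N, 0%N. Qed.

Lemma aligned_sym a c : aligned a c -> aligned c a.
Proof. by case=> m [k e]; exists k, m. Qed.

Lemma aligned_trans c a d : aligned a c -> aligned c d -> aligned a d.
Proof.
move=> [m [k e]] [m' [k' e']]; exists (m' + m)%N, (k + k')%N.
by rewrite iterD e -iterD addnC iterD e' -iterD.
Qed.

Lemma aligned_XY a : aligned a (f a).
Proof. by exists 1%N, 0%N. Qed.

Lemma aligned_twig n j : has_twig n -> (j.+1 < q)%N -> aligned (Vertex n 0) (Twig n j.+1).
Proof.
move=> tn; elim: j => [|j IHj] jq.
  by rewrite -XY_twig_start //; exact: aligned_XY.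
apply: aligned_trans (IHj _) _; first exact: ltnW.
by rewrite -(XY_twig tn _ jq) //; exact: aligned_XY.
Qed.

Lemma aligned_leaf n i : (i < p.-1)%N -> aligned (Vertex n 0) (Vertex n i).
Proof.
elim: i => [|i IHi] ip; first exact: aligned_refl.
case tn: ((i == 0%N) && has_twig n); last first.
  apply: aligned_trans (IHi _) _; first exact: ltnW.
  by rewrite -(@XY_leaf n i) ?tn //; [exact: aligned_XY|lia].
case/andP: tn => /eqP -> tn; apply: (@aligned_trans (Twig n q.-1)).
  have -> : q.-1 = q.-2.+1 by lia.
  by apply: aligned_twig => //; lia.
by rewrite -XY_twig_end //; exact: aligned_XY.
Qed.

Lemma aligned_spine n j :
  (1 < j < q)%N -> aligned (Vertex (n + 1)%R p.-1) (Joint n j).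
Proof.
elim: j => //= j IHj /andP[j1 jq]; have [j0|{}j1] := leqP j 1.
  have j1' : j = 1%N by lia.
  by rewrite j1' -XY_spine_start; [exact: aligned_XY|lia].
apply: aligned_trans (IHj _) _; first by rewrite j1 ltnW.
by rewrite -(XY_spine _ j1 jq); exact: aligned_XY.
Qed.

Lemma aligned_hubs (h : int -> point) :
  (forall n, aligned (h n) (h (n + 1)%R)) -> forall n, aligned (h n) (h 0%R).
Proof.
move=> step; elim/ssrint.int_rect => [|n IHn|n IHn]; first exact: aligned_refl.
  apply: aligned_trans IHn; apply: aligned_sym.
  by have -> : Posz n.+1 = (n%:Z + 1)%R by lia.
apply: aligned_trans IHn.
by have -> : (- n%:Z = - n.+1%:Z + 1)%R by lia.
Qed.

Lemma aligned_top a : valid a -> ~~ bottom a -> aligned a (Vertex 0 0).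
Proof.
move=> va ta; have [n an] : exists n, aligned a (Vertex n 0).
  case: a va ta => [n i|//|n j] /=; exists n; apply: aligned_sym.
    by apply: aligned_leaf; lia.
  by case: j va => [|j] /andP[tn jq] //; apply: aligned_twig.
apply: aligned_trans an _; apply: (@aligned_hubs (fun n => Vertex n 0)) => {}n.
apply: aligned_trans (aligned_leaf _ _) _; last first.
  by rewrite -XY_next; exact: aligned_XY.
lia.
Qed.

Lemma aligned_bottom a : valid a -> bottom a -> aligned a (Vertex 0 p.-1).
Proof.
move=> va ta; have [n an] : exists n, aligned a (Vertex n p.-1).
  case: a va ta => [n i|n j|//] /= ia.
    by move/eqP ->; exists n; exact: aligned_refl.
  by exists (n + 1)%R; apply/aligned_sym/aligned_spine.
apply: aligned_trans an _; apply: (@aligned_hubs (fun n => Vertex n p.-1)) => {}n.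
apply: aligned_sym; have [q3|q2] := ltnP 2 q.
  apply: (@aligned_trans (Joint n q.-1)); first by apply: aligned_spine; lia.
  by rewrite -XY_spine_end //; exact: aligned_XY.
by rewrite -[Vertex n _]XY_spine2; [exact: aligned_XY|lia].
Qed.

(** * Congruences of the caterpillar *)

Section Congruence.
Variable E : point -> point -> Prop.
Hypotheses (E_sym : forall a c, E a c -> E c a)
           (E_trans : forall a c d, E a c -> E c d -> E a d)
           (EX : forall a c, E a c -> E (catX a) (catX c))
           (EY : forall a c, E a c -> E (catY a) (catY c)).

Lemma E_iter (h : point -> point) k a c :
  (forall a c, E a c -> E (h a) (h c)) -> E a c -> E (iter k h a) (iter k h c).
Proof. by move=> Eh Eac; elim: k => //= k; exact: Eh. Qed.

Lemma E_XY k a c : E a c -> E (iter k f a) (iter k f c).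
Proof. by apply: E_iter => {}a {}c ?; apply/EY/EX. Qed.

Lemma E_XYinv k a c : E a c -> E (iter k finv a) (iter k finv c).
Proof. by apply: E_iter => {}a {}c ?; apply/E_iter/E_iter. Qed.

Lemma iter_fK d : cancel (iter d f) (iter d finv).
Proof. by apply: iter_XYK; [lia|lia|exact: catX_period|exact: catY_period]. Qed.

Lemma E_XYV k a c : E (iter k f a) (iter k f c) -> E a c.
Proof. by move/(E_XYinv k); rewrite !iter_fK. Qed.

(** Since XY preserves E in both directions, a period at one point of a face is a
    period at all its points. *)
Lemma period_aligned d a c :
  aligned a c -> E c (iter d f c) -> E a (iter d f a).
Proof.
move=> [m [k e]] /(E_XY k); rewrite -iterD addnC iterD -e -iterD addnC iterD.
exact: E_XYV.
Qed.

Lemma aligned_period a c :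
  aligned a c -> E a c -> a <> c ->
  exists2 d, (0 < d)%N & E a (iter d f a).
Proof.
move=> ac Eac nac; have [m [k e]] := ac.
have Ekm : E (iter k f c) (iter m f c) by rewrite -e; exact: E_XY.
have [mk|km|mk] := ltngtP m k; last first.
- by case: nac; apply: (can_inj (iter_fK k)); rewrite -e mk.
- exists (m - k)%N; first by rewrite subn_gt0.
  apply: period_aligned ac _; apply: (@E_XYV k).
  by rewrite -iterD subnKC // ltnW.
- exists (k - m)%N; first by rewrite subn_gt0.
  apply: period_aligned ac _; apply: (@E_XYV m).
  rewrite -iterD subnKC ?(ltnW mk) //; exact: E_sym.
Qed.

Lemma period1_aligned a c : E a (f a) -> aligned c a -> E a c.
Proof.
move=> Eaf [m [k e]].
have Eak i : E a (iter i f a).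
  elim: i => [|i IHi]; first exact: E_trans Eaf (E_sym Eaf).
  by apply: E_trans Eaf _; rewrite iterS; apply: (@E_XY 1).
by apply: (@E_XYV m); rewrite e; apply: E_trans (Eak k); exact: E_sym.
Qed.

Notation w := (Vertex 0 0).

Lemma twig0 : f w = Twig 0 1. Proof. exact: XY_twig_start. Qed.

(** The X-fixed point t = Twig 0 1 has an equivalent point c at distance d behind
    it on the top face.  The height of c is at most 0, which leaves for c only the
    starting point and the X-cycles of negative index, where there are no twigs.
    All the points of such an X-cycle are equivalent to t. *)
Lemma period_top d : (0 < d)%N -> E w (iter d f w) -> E w (f w).
Proof.
move=> d0 Ed; set c := iter d finv (Twig 0 1).
have fc : iter d f c = Twig 0 1 by exact: iter_finvK.
have vt : valid (Twig 0 1) by rewrite /=; lia.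
have vc : valid c by apply: valid_iter => //; exact: valid_XYinv.
have tc : ~~ bottom c by rewrite -(bottom_iter d vc) fc.
have hc : (height c + d%:Z <= 1)%R by have := height_iter d vc; rewrite fc.
have Ect : E c (Twig 0 1).
  by rewrite -fc; apply: (period_aligned _ Ed); exact: aligned_top.
move: c Ect tc vc hc {fc} => [n i|//|n j] Ect /= tc vc; rewrite ?(negPf tc).
  case: n Ect => [[|n]|n] Ect.
  - case: eqP Ect => [-> Ect _|_ _ h]; first by rewrite twig0.
    by exfalso; lia.
  - by case: eqP => _ h; exfalso; lia.
  move=> _; have EXk k : E (iter k catX (Vertex (Negz n) i)) (Twig 0 1).
    suff <- : iter k catX (Twig 0 1) = Twig 0 1 by apply: E_iter.
    by elim: k => //= k ->.
  have Xi k : (i + k < p)%N ->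
      iter k catX (Vertex (Negz n) i) = Vertex (Negz n) (i + k).
    elim: k => [|k IHk] ik; first by rewrite addn0.
    by rewrite iterS IHk ?addnS /catX /csucc; [rewrite -addnS ik|lia].
  have E0 : E (Vertex (Negz n) 0) (Twig 0 1).
    have := EXk (p.-1 - i).+1; rewrite iterS Xi; last lia.
    by rewrite subnKC ?catX_wrap //; lia.
  have E1 : E (Vertex (Negz n) 1) (Twig 0 1).
    by have := EX E0; rewrite /= /csucc ltnW.
  apply: (@period_aligned 1 _ (Vertex (Negz n) 0)).
    by apply/aligned_sym/aligned_top => //=; lia.
  by rewrite /= XY_leaf //; apply: E_trans E0 (E_sym E1).
by case: n vc {Ect} => [n|//] vc h; exfalso; lia.
Qed.

(** Only the case of a bottom point c needs an argument.  Transporting along the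
    faces, the Y-fixed top point F becomes equivalent to some bottom point b', so
    also to its image under Y.  Either this image is on top and it is the second
    top point, or b' is fixed by X and the image is the successor of b' on the
    bottom face; the bottom is then one class, and X carries the right spine
    points of two X-cycles to two equivalent top points. *)
Lemma congruence_period c :
  valid c -> c <> w -> E w c -> exists2 d, (0 < d)%N & E w (iter d f w).
Proof.
move=> vc cw Ewc; have top a a' : valid a -> ~~ bottom a -> valid a' ->
    ~~ bottom a' -> a <> a' -> E a a' -> exists2 d, (0 < d)%N & E w (iter d f w).
  move=> va ta va' ta' aa' Eaa'.
  have [|d d0 Ed] := aligned_period _ Eaa' aa'.
    by apply: aligned_trans (aligned_top va ta) _; apply/aligned_sym/aligned_top.
  by exists d => //; apply: period_aligned Ed; apply/aligned_sym/aligned_top.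
have vw : valid w by rewrite /=; lia.
have tw : ~~ bottom w by rewrite /=; lia.
have [bc|tc] := boolP (bottom c); last by apply: (top w c) => // /esym.
set F := Vertex (-1)%R 1.
have vF : valid F by rewrite /=; lia.
have tF : ~~ bottom F by rewrite /=; lia.
have [m [k e]] := aligned_top vF tF.
pose b' := iter m finv (iter k f c).
have vb : valid b'.
  apply: valid_iter; first exact: valid_XYinv.
  by apply: valid_iter => //; exact: valid_XY.
have bb : bottom b'.
  by rewrite -(bottom_iter m vb) iter_finvK bottom_iter.
have EFb : E F b'.
  by apply: (@E_XYV m); rewrite e iter_finvK; exact: E_XY.
have YF : catY F = F by rewrite /=; case: ifP => [|_]; first lia.
have EFY : E F (catY b') by rewrite -YF; exact: EY.
move: b' vb bb EFb EFY => [n i|n j|//] vb bb EFb EFY.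
  move: EFY; rewrite [catY _]/= (_ : i == p.-1) // => EFY.
  by apply: (top F (Vertex (n + 1) 0)%R) => //=; lia.
have Ebb : E (Joint n j) (f (Joint n j)) by exact: E_trans (E_sym EFb) EFY.
have ER k' : E (Joint n j) (Vertex k' p.-1).
  apply: period1_aligned => //; apply: aligned_trans (aligned_bottom _ _) _ => //=; try lia.
  by apply/aligned_sym/aligned_bottom.
have := EX (E_trans (E_sym (ER 0%R)) (ER 1%R)); rewrite !catX_wrap.
by apply: top => //=; lia.
Qed.

End Congruence.

(** With period 1 the top face is in the class of the starting point; X sends
    the starting point to a top point, and Y fixes the top point Vertex (-1) 1. *)
Lemma congruence_closed E :
  (forall a c, E a c -> E c a) -> (forall a c d, E a c -> E c d -> E a d) ->
  (forall a c, E a c -> E (catX a) (catX c)) ->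
  (forall a c, E a c -> E (catY a) (catY c)) ->
  forall c, valid c -> c <> Vertex 0 0 -> E (Vertex 0 0) c ->
  forall a, E (Vertex 0 0) a -> E (Vertex 0 0) (catX a) /\ E (Vertex 0 0) (catY a).
Proof.
move=> Es Et EX EY c vc cw Ec a Ea.
have [d d0 Ed] := congruence_period Es Et EX EY vc cw Ec.
have E1 := period_top Es Et EX EY d0 Ed.
have top e : valid e -> ~~ bottom e -> E (Vertex 0 0) e.
  by move=> ve te; apply: period1_aligned => //; exact: aligned_top.
split.
  have X0 : catX (Vertex 0 0) = Vertex 0 1 by rewrite /= /csucc ltnW.
  by apply: Et (EX _ _ Ea); rewrite X0; apply: top; rewrite /=; lia.
set F := Vertex (-1)%R 1.
have YF : catY F = F by rewrite /=; case: ifP => [|_]; first lia.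
have EF : E (Vertex 0 0) F by apply: top; rewrite /=; lia.
apply: (Et) (EF) _; rewrite -YF; apply: (EY); exact: Et (Es _ _ EF) Ea.
Qed.

End Caterpillar.

(** * The stabilizers, and how many there are *)

Section CaterpillarStabilizer.
Variables (p q : nat).
Hypotheses (p_ge3 : (3 <= p)%N) (q_ge2 : (2 <= q)%N).

Local Notation act b := (act (catX p) (catY p q b)).

Definition caterpillar_stab b : set (Delta p q) :=
  stab (catX p) (catY p q b) (Vertex 0 0).

Let p_gt0 : (0 < p)%N. Proof. by lia. Qed.
Let q_gt0 : (0 < q)%N. Proof. by lia. Qed.
Let Xp a : iter p (catX p) a = a. Proof. exact: catX_period. Qed.
Let Yq b a : iter q (catY p q b) a = a. Proof. exact: catY_period. Qed.

Lemma valid_act b (g : Delta p q) a : valid p q b a -> valid p q b (act b g a).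
Proof.
apply: (act_closed (P := valid p q b)) => {}a va.
  exact: valid_catX.
exact: valid_catY.
Qed.

Lemma caterpillar_stab_maximal b : nonparabolic_maximal (caterpillar_stab b).
Proof.
have vw : valid p q b (Vertex 0 0) by [].
split; last first.
  apply: (stab_nonparabolic p_gt0 q_gt0 Xp (Yq b)) => g n e.
  have := height_iter p_ge3 q_ge2 n.+1 (valid_act g vw); rewrite e; lia.
apply: (stab_maximal p_gt0 q_gt0 Xp (Yq b)).
  exists (DeltaX p q); rewrite actX // /= /csucc ltnW //.
move=> E Es Et EX EY g Eg ng h.
apply: (act_closed (P := E (Vertex 0 0))); last exact: Et (Eg) (Es _ _ Eg).
- move=> a /(congruence_closed p_ge3 q_ge2 Es Et EX EY (valid_act g vw) ng Eg).
  by case.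
- move=> a /(congruence_closed p_ge3 q_ge2 Es Et EX EY (valid_act g vw) ng Eg).
  by case.
Qed.

Lemma caterpillar_stab_not_neumann b : ~ neumann_subgroup (caterpillar_stab b).
Proof.
have vw : valid p q b (Vertex 0 0) by [].
apply: (stab_not_neumann p_gt0 q_gt0 Xp (Yq b)
          (P := fun a => valid p q b a /\ ~~ bottom p a)).
- by split=> //=; lia.
- move=> a; split=> [[va ta]|[va ta]].
    have va' : valid p q b a.
      rewrite -(XYK p_gt0 q_gt0 Xp (Yq b) a); exact: valid_XYinv.
    by rewrite -(bottom_XY p_ge3 q_ge2 va').
  by rewrite bottom_XY //; split=> //; exact: valid_XY.
exists (DeltaX p q ^+ p.-1)%g => -[_].
suff -> : act b (DeltaX p q ^+ p.-1)%g (Vertex 0 0) = Vertex 0 p.-1 by rewrite /= eqxx.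
have Xk k : (k < p)%N -> act b (DeltaX p q ^+ k)%g (Vertex 0 0) = Vertex 0 k.
  elim: k => [|k IHk] kp; first by rewrite act1.
  by rewrite expgSr actM // IHk ?actX //= ?/csucc ?kp // ltnW.
by apply: Xk; lia.
Qed.

(** X^-1 Y moves from an X-cycle to the next one; the last X goes to the point
    that carries the twig, if there is one. *)
Definition to_leaf (n : nat) : Delta p q :=
  ((DeltaX p q ^- 1 * DeltaY p q) ^+ n * DeltaX p q)%g.

Lemma act_to_leaf b n : act b (to_leaf n) (Vertex 0 0) = Vertex n%:Z 1.
Proof.
rewrite actM // actX //.
suff -> : act b ((DeltaX p q ^- 1 * DeltaY p q) ^+ n)%g (Vertex 0 0) = Vertex n%:Z 0.
  by rewrite /= /csucc ltnW.
elim: n => [|n IHn]; first by rewrite act1.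
rewrite expgSr actM // IHn actM //.
have -> : act b (DeltaX p q ^- 1)%g (Vertex n 0) = Vertex n p.-1.
  apply: (can_inj (actVK p_gt0 q_gt0 Xp (Yq b) (DeltaX p q ^- 1)%g)).
  by rewrite actK // invgK expg1 actX // (catX_wrap p_ge3 q_ge2).
rewrite actY //= eqxx /spine_cycle /=; congr Vertex; lia.
Qed.

Lemma caterpillar_stab_leaf b n :
  caterpillar_stab b (to_leaf n.+1 * DeltaY p q * (to_leaf n.+1)^-1)%g <-> ~~ b n.
Proof.
rewrite /caterpillar_stab /stab /= -mulgA actM // act_to_leaf actM // actY //.
have Ye : catY p q b (Vertex n.+1 1) = if b n then Twig n.+1 1 else Vertex n.+1 1.
  by rewrite /=; case: ifP => [|_]; first lia.
split=> [e|/negPf nb].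
  have := congr1 (act b (to_leaf n.+1)) e.
  by rewrite actVK // act_to_leaf Ye; case: (b n).
by rewrite Ye nb -(act_to_leaf b) actK.
Qed.

Lemma caterpillar_stab_inj : injective caterpillar_stab.
Proof.
move=> b c e; apply/funext => n; apply: negb_inj; apply/idP/idP.
  by move=> /caterpillar_stab_leaf; rewrite e => /caterpillar_stab_leaf.
by move=> /caterpillar_stab_leaf; rewrite -e => /caterpillar_stab_leaf.
Qed.

End CaterpillarStabilizer.

Lemma countable_Delta p q : countable [set: Delta p q].
Proof.
pose code (g : tgen) : nat := match g with tX => 0 | tY => 1 | tZ => 2 end.
have code_inj : injective code by case; case.
pose wcode (w : word tgen) := pickle [seq (code l.1, l.2) | l <- w].
apply/countable_injP; exists (fun g => wcode (repr g)) => g h _ _ e.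
rewrite -(pres_reprK g) -(pres_reprK h); congr pres_of.
move: e => /(pcan_inj (@pickleK _)); apply: inj_map => -[x s] [y t] [].
by move=> /code_inj -> ->.
Qed.

(** Cantor's diagonal argument. *)
Lemma uncountable_bitstreams : ~ countable [set: nat -> bool].
Proof.
move=> /countable_injP[h inj_h].
pose d n := ~~ `[< exists2 b, h b = n & b n >].
have : d (h d) = ~~ d (h d).
  rewrite {1}/d; congr negb; apply/asboolP/idP => [[b hb bn]|dd].
    have e : b = d by apply: inj_h; rewrite ?inE.
    by rewrite -{1}e.
  by exists d.
by case: (d (h d)).
Qed.

Theorem theorem10 (p q : nat) (hp : (3 <= p)%N) (hq : (2 <= q)%N) :
  ~ countable
      [set C : set (set (Delta p q)) | exists M : set (Delta p q),
         [/\ nonparabolic_maximal M, ~ neumann_subgroup M &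
             C = conjugacy_class M]].
Proof.
set S := (catX in countable catX) => cS.
have cU : countable (\bigcup_(C in S) C).
  apply: bigcup_countable => // _ [M [_ _ ->]].
  apply: sub_countable (countable_Delta p q); exact: card_image_le.
have /countable_injP[h inj_h] := cU.
apply: uncountable_bitstreams.
apply/countable_injP; exists (h \o @caterpillar_stab p q) => b c _ _ /= /inj_h e.
have inU b' : caterpillar_stab b' \in \bigcup_(C in S) C.
  rewrite inE; exists (conjugacy_class (@caterpillar_stab p q b')).
    exists (caterpillar_stab b'); split=> //; first exact: caterpillar_stab_maximal.
    exact: caterpillar_stab_not_neumann.
  exists 1%g => //; apply/seteqP; split=> [_ [x Mx <-]|x Mx].
    by rewrite conjg1.
  by exists x => //; rewrite conjg1.
by apply: (caterpillar_stab_inj hp hq); apply: e; exact: inU.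
Qed.
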